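(* Let $a\in\mathbb{R}_{>0}$ and $m\in\mathbb{Z}_{\geq 2}$. For $0\le r\le m$ put $$f_{m,a}(r)=\frac{1}{(1+a)^r}\sum_{i=0}^{r}\binom{m}{i}a^i .$$ Then the sequence $\{f_{m,a}(r)\}_{r=0}^{m}$ is log-concave, and thus unimodal.
   Context: A sequence of nonnegative reals $\{x_i\}$ is log-concave if $x_k^2\ge x_{k-1}x_{k+1}$ for all $k\ge1$ (for which these terms are defined). *)

(* Defs.v *)
From mathcomp Require Import all_boot all_order all_algebra.
From mathcomp Require Import reals.

Set Implicit Arguments.
Unset Strict Implicit.
Unset Printing Implicit Defensive.

Import Order.TTheory GRing.Theory Num.Theory.
Local Open Scope ring_scope.

(* A finite sequence x_0, ..., x_n is a function [x : nat -> R] together with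
   its last index n; its values beyond n are irrelevant. *)
Definition log_concave (R : realType) (n : nat) (x : nat -> R) : Prop :=
  (forall k : nat, (k <= n)%N -> 0 <= x k) /\
  (forall k : nat, (1 <= k)%N -> (k.+1 <= n)%N ->
     x k.-1 * x k.+1 <= x k ^+ 2).

Definition unimodal (R : realType) (n : nat) (x : nat -> R) : Prop :=
  exists p : nat,
    [/\ (p <= n)%N,
        forall i j : nat, (i <= j)%N -> (j <= p)%N -> x i <= x j
      & forall i j : nat, (p <= i)%N -> (i <= j)%N -> (j <= n)%N -> x j <= x i].

Definition f (R : realType) (m : nat) (a : R) (r : nat) : R :=
  1 / (1 + a) ^+ r * \sum_(0 <= i < r.+1) 'C(m, i)%:R * a ^+ i.

(* Main.v *)
Require Import Defs.
From mathcomp Require Import all_boot all_order all_algebra.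
From mathcomp Require Import reals.
From mathcomp Require Import zify lra.

Import Order.TTheory GRing.Theory Num.Theory.
Local Open Scope ring_scope.

(** The powers of [1 + a] cancel in [f (k-1) * f (k+1) <= f k ^ 2], so log-concavity of
    [f] is that of the partial sums [S k = \sum_(i <= k) x i] with [x i = 'C(m, i) a^i].
    Since [S k ^ 2 - S (k-1) * S (k+1) = x k * S k - S (k-1) * x (k+1)], this follows by
    summing [x i * x (k+1) <= x (i+1) * x k] over [i < k].  A positive log-concave
    sequence is unimodal because its successive ratios are nonincreasing. *)

(** The ratio ['C(m, k.+1) / 'C(m, k) = (m - k) / k.+1] decreases in [k]; stated cross-multiplied to
    stay in [nat]. *)
Lemma bin_cross (m i k : nat) : (i <= k)%N ->
  ('C(m, i) * 'C(m, k.+1) <= 'C(m, i.+1) * 'C(m, k))%N.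
Proof.
move=> leik; have [ltmk|lekm] := ltnP m k.+1.
  by rewrite (bin_small ltmk) muln0.
rewrite -(leq_pmul2l (isT : 0 < i.+1 * k.+1)%N) mulnACA mul_bin_left.
rewrite [leqRHS]mulnACA mul_bin_left.
rewrite mulnACA [leqRHS]mulnACA [((m - i) * _)%N]mulnC leq_mul2r.
by rewrite leq_mul ?orbT ?leq_sub2l.
Qed.

Lemma partial_sum_log_concave (R : realDomainType) (x : nat -> R) (k : nat) :
  (forall i, 0 <= x i) ->
  (forall i j, (i <= j)%N -> x i * x j.+1 <= x i.+1 * x j) ->
  (\sum_(0 <= i < k.+1) x i) * (\sum_(0 <= i < k.+3) x i)
    <= (\sum_(0 <= i < k.+2) x i) ^+ 2.
Proof.
move=> x_ge0 x_cross.
have H : (\sum_(0 <= i < k.+1) x i) * x k.+2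
    <= (\sum_(0 <= i < k.+2) x i) * x k.+1.
  (* Dropping the term [x 0 * x k.+1 >= 0] shifts the right sum by one, so [x_cross] applies
     termwise. *)
  rewrite [X in _ <= X * _]big_nat_recl// mulrDl !mulr_suml ler_wpDl ?mulr_ge0//.
  by apply: ler_sum_nat => i /andP[_ lti]; apply: x_cross; lia.
rewrite [X in _ * X]big_nat_recr//=.
move: H; rewrite [\sum_(0 <= i < k.+2) _]big_nat_recr//= => H; nra.
Qed.

Lemma log_concave_gt0_unimodal (R : realType) (n : nat) (x : nat -> R) :
  (forall k, (k <= n)%N -> 0 < x k) -> log_concave n x -> unimodal n x.
Proof.
move=> x_gt0 [_ lc].
(* The peak [p] is the first index not followed by a strict ascent, or [n] if there is none. *)
have exP : exists k, (k == n) || (x k.+1 <= x k) by exists n; rewrite eqxx.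
case: (ex_minnP exP) => p Pp minp.
have lepn : (p <= n)%N by apply: minp; rewrite eqxx.
have desc k : (p <= k)%N -> (k < n)%N -> x k.+1 <= x k.
  elim: k => [|k IH] lepk ltkn.
    have p0 : p = 0%N by lia.
    by move: Pp; rewrite p0 => /orP[/eqP|//]; lia.
  have [epk|nepk] := eqVneq p k.+1.
    by move: Pp; rewrite epk => /orP[/eqP|//]; lia.
  have xk : x k.+1 <= x k by apply: IH; lia.
  have := lc k.+1 isT ltkn; rewrite /= => lck.
  have xk0 : 0 < x k by apply: x_gt0; lia.
  have xk1 : 0 < x k.+1 by apply: x_gt0; lia.
  (* [x k * x k.+2 <= x k.+1 ^+ 2 <= x k * x k.+1]; cancel [x k]. *)
  rewrite -(ler_pM2l xk0); apply: (le_trans lck).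
  by rewrite expr2 ler_wpM2r// ltW.
exists p; split=> // i j.
  elim: j => [|j IH] leij lejp; first by have -> : i = 0%N by lia.
  have [->//|neij] := eqVneq i j.+1.
  apply: (@le_trans _ _ (x j)); first by apply: IH; lia.
  apply/ltW; rewrite ltNge; apply/negP => xj.
  by have := minp j; rewrite xj orbT => /(_ isT); lia.
move=> lepi; elim: j => [|j IH] leij lejn; first by have -> : i = 0%N by lia.
have [->//|neij] := eqVneq i j.+1.
by apply: (@le_trans _ _ (x j)); [apply: desc|apply: IH]; lia.
Qed.

Lemma f_gt0 (R : realType) (m : nat) (a : R) (r : nat) : 0 < a -> 0 < f m a r.
Proof.
move=> a0; rewrite /f mulr_gt0 ?divr_gt0 ?exprn_gt0 ?addr_gt0//.
(* Strictness comes from the term [i = 0], which is 1. *)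
rewrite big_nat_recl//= bin0 mul1r ltr_wpDr//.
by apply: sumr_ge0 => i _; rewrite mulr_ge0 ?exprn_ge0 ?ler0n// ltW.
Qed.

Lemma f_log_concave (R : realType) (m : nat) (a : R) (n : nat) :
  0 < a -> log_concave n (f m a).
Proof.
move=> a0; split=> [k _|[//|k] _ _ /=]; first exact/ltW/f_gt0.
rewrite /f !div1r exprMn mulrACA -invfM -exprD.
have -> : (k + k.+2 = k.+1 * 2)%N by lia.
rewrite exprVn -exprM ler_wpM2l ?invr_ge0 ?exprn_ge0 ?addr_ge0 ?(ltW a0)//.
apply: (@partial_sum_log_concave R (fun i => 'C(m, i)%:R * a ^+ i)) => [i|i j leij].
  by rewrite mulr_ge0 ?exprn_ge0 ?ler0n// ltW.
(* Both sides carry the same power of [a], leaving [bin_cross]. *)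
rewrite mulrACA [leRHS]mulrACA -!exprD -!natrM addnS addSn.
by rewrite ler_wpM2r ?exprn_ge0 ?(ltW a0)// ler_nat bin_cross.
Qed.

Theorem theorem1p1 (R : realType) (a : R) (m : nat) (ha : 0 < a)
    (hm : (2 <= m)%N) :
  log_concave m (f m a) /\ unimodal m (f m a).
Proof.
have lc := f_log_concave R m a m ha.
by split=> //; apply: log_concave_gt0_unimodal lc => k _; apply: f_gt0.
Qed.
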